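(* For $0\le k\le N_T$ let $$J_{\mathrm{ave},k}=Z_k\sum_{j=1}^{k}\left(Z_j^{-1}-Z_{j-1}^{-1}\right)J_j .$$ Consider the constrained two-player zero-sum game with payoff matrix $Z$, transmitter strategy set $\mathbf{X}$ and jammer strategy set $\mathbf{Y}_{\mathrm{LE}|J_{\mathrm{ave}}}$, and assume that $$J_{\mathrm{ave},m}<J_{\mathrm{ave}}<J_{\mathrm{ave},m+1}\quad\text{for some } m\in\{0,\dots,N_T-1\}.$$ Then the value of the game at the Nash equilibrium is $$Z(\boldsymbol{x}^*,\boldsymbol{y}^* )=\frac{J_{m+1}-J_{\mathrm{ave}}}{J_{m+1}-J_{\mathrm{ave},m}}\,Z_m,$$ and a Nash equilibrium pair $(\boldsymbol{x}^*,\boldsymbol{y}^* )$ of optimal mixed strategies is given by $$x_i^*=\frac{Z_m}{J_{m+1}-J_{\mathrm{ave},m}}\,(J_{i+1}-J_i)\,Z_i^{-1}\quad(0\le i\le m),\qquad x_i^*=0\quad(m<i\le N_T),$$ and, with $a=\dfrac{J_{m+1}-J_{\mathrm{ave}}}{J_{m+1}-J_{\mathrm{ave},m}}$, $$y_0^*=aZ_mZ_0^{-1},\qquad y_j^*=aZ_m\left(Z_j^{-1}-Z_{j-1}^{-1}\right)\ (1\le j\le m),\qquad y_{m+1}^*=aZ_m\cdot\frac{J_{\mathrm{ave}}-J_{\mathrm{ave},m}}{J_{m+1}-J_{\mathrm{ave}}}\,Z_m^{-1},$$ and $y_j^*=0$ for $m+1<j\le N_T$.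
   Context: Let $N_T\ge 1$ be an integer. Jamming power levels: real numbers $0=J_0<J_1<\dots<J_{N_T}=J_{\max}$, collected in the column vector $\boldsymbol{J}=(J_0,\dots,J_{N_T})^T$. Payoffs: real numbers $Z_0>Z_1>\dots>Z_{N_T}>0$. The payoff matrix $Z$ is the $(N_T+1)\times(N_T+1)$ lower triangular matrix, indexed by $0\le i,j\le N_T$, with $(i,j)$ entry equal to $Z_i$ if $j\le i$ and $0$ if $j>i$ (the transmitter, using a strategy that withstands jamming power up to $J_i$, receives $Z_i$ if the actual jamming power $J_j$ satisfies $J_j\le J_i$, and $0$ otherwise). The row player (transmitter) maximizes and the column player (jammer) minimizes. $\mathbf{X}=\mathbf{Y}$ is the set of probability vectors in $\mathbb{R}^{N_T+1}$ (entries indexed by $0,\dots,N_T$). For $0\le J_{\mathrm{ave}}\le J_{\max}$, $\mathbf{Y}_{\mathrm{LE}|J_{\mathrm{ave}}}=\{\boldsymbol{y}\in\mathbf{Y}: \boldsymbol{y}^T\boldsymbol{J}\le J_{\mathrm{ave}}\}$. The expected payoff is $Z(\boldsymbol{x},\boldsymbol{y})=\boldsymbol{x}^TZ\boldsymbol{y}$. An empty sum is $0$. A Nash equilibrium is a pair $(\boldsymbol{x}^*,\boldsymbol{y}^* )\in\mathbf{X}\times\mathbf{Y}_{\mathrm{LE}|J_{\mathrm{ave}}}$ such that $Z(\boldsymbol{x},\boldsymbol{y}^* )\le Z(\boldsymbol{x}^*,\boldsymbol{y}^* )\le Z(\boldsymbol{x}^*,\boldsymbol{y})$ for all $\boldsymbol{x}\in\mathbf{X}$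 and $\boldsymbol{y}\in\mathbf{Y}_{\mathrm{LE}|J_{\mathrm{ave}}}$; $\boldsymbol{x}^*,\boldsymbol{y}^*$ are then called optimal mixed strategies and $Z(\boldsymbol{x}^*,\boldsymbol{y}^* )$ the game value. *)

(* Defs.v *)
From mathcomp Require Import all_boot all_order all_algebra.

Set Implicit Arguments.
Unset Strict Implicit.
Unset Printing Implicit Defensive.

Import Order.TTheory GRing.Theory Num.Theory.

Local Open Scope ring_scope.

(* Jamming powers J_0, ..., J_N and payoffs Z_0, ..., Z_N are the values at
   0, ..., N of functions nat -> R; values beyond N are never used. *)

Section Game.

Variables (R : realFieldType) (N : nat).
Implicit Types (J Z : nat -> R) (x y : 'cV[R]_(N.+1)).

Definition power_vector J : 'cV[R]_(N.+1) := \col_j J j.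

Definition payoff_matrix Z : 'M[R]_(N.+1) :=
  \matrix_(i, j) if (j <= i)%N then Z i else 0.

Definition expected_payoff Z x y : R := (x^T *m payoff_matrix Z *m y) 0 0.

Definition prob_vector x : Prop :=
  (forall i, 0 <= x i 0) /\ \sum_i x i 0 = 1.

Definition jammer_strategy J (Jave : R) y : Prop :=
  prob_vector y /\ (y^T *m power_vector J) 0 0 <= Jave.

Definition nash_equilibrium J Z (Jave : R) x y : Prop :=
  [/\ prob_vector x,
      jammer_strategy J Jave y,
      forall x', prob_vector x' ->
        expected_payoff Z x' y <= expected_payoff Z x y
    & forall y', jammer_strategy J Jave y' ->
        expected_payoff Z x y <= expected_payoff Z x y'].

Definition Jave_threshold J Z (k : nat) : R :=
  Z k * \sum_(1 <= j < k.+1) ((Z j)^-1 - (Z j.-1)^-1) * J j.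

Definition transmitter_opt J Z (m : nat) : 'cV[R]_(N.+1) :=
  \col_i if (i <= m)%N then
           Z m / (J m.+1 - Jave_threshold J Z m) * (J i.+1 - J i) * (Z i)^-1
         else 0.

Definition jammer_scale J Z (Jave : R) (m : nat) : R :=
  (J m.+1 - Jave) / (J m.+1 - Jave_threshold J Z m).

Definition jammer_opt J Z (Jave : R) (m : nat) : 'cV[R]_(N.+1) :=
  let a := jammer_scale J Z Jave m in
  \col_j if j == 0%N :> nat then a * Z m * (Z 0%N)^-1
         else if (j <= m)%N then a * Z m * ((Z j)^-1 - (Z j.-1)^-1)
         else if j == m.+1 :> nat then
           a * Z m * ((Jave - Jave_threshold J Z m) / (J m.+1 - Jave))
             * (Z m)^-1
         else 0.

End Game.

(* Main.v *)
Require Import Defs.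
From mathcomp Require Import all_boot all_order all_algebra.
From mathcomp Require Import ring lra.

(** Against the proposed [x*], the column payoffs are at least the affine
    function [Z_m (J_{m+1} - J_j) / (J_{m+1} - J_{ave,m})] of the power [J_j],
    so a jammer of average power at most [J_ave] concedes at least the claimed
    value [v].  Against [y*], the rows [i <= m] pay exactly [v] and the rows
    [i > m] pay [Z_i <= Z_{m+1} <= v], the last inequality being
    [J_ave <= J_{ave,m+1}].  Two strategies guaranteeing the same [v] form an
    equilibrium and force the payoff of every equilibrium to be [v]. *)

Set Implicit Arguments.
Unset Strict Implicit.
Unset Printing Implicit Defensive.

Import Order.TTheory GRing.Theory Num.Theory.

Local Open Scope ring_scope.

(** * Payoff guarantees and saddle points *)

Section ExpectedPayoff.

Variables (R : realFieldType) (N : nat).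
Implicit Types (J Z : nat -> R) (x y : 'cV[R]_(N.+1)).

Lemma expected_payoff_rows Z x y :
  expected_payoff Z x y =
  \sum_i x i 0 * (Z i * \sum_(j : 'I_N.+1 | (j <= i)%N) y j 0).
Proof.
rewrite /expected_payoff -mulmxA mxE; apply: eq_bigr => i _.
rewrite !mxE; congr (_ * _); rewrite [in RHS]big_mkcond mulr_sumr.
by apply: eq_bigr => j _; rewrite mxE; case: ifP; rewrite ?mul0r ?mulr0.
Qed.

Lemma expected_payoff_cols Z x y :
  expected_payoff Z x y =
  \sum_(j : 'I_N.+1) (\sum_(i : 'I_N.+1 | (j <= i)%N) x i 0 * Z i) * y j 0.
Proof.
rewrite /expected_payoff mxE; apply: eq_bigr => j _.
rewrite mxE [in RHS]big_mkcond; congr (_ * _).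
by apply: eq_bigr => i _; rewrite !mxE; case: ifP; rewrite ?mulr0.
Qed.

Lemma average_powerE J y : (y^T *m power_vector N J) 0 0 = \sum_j y j 0 * J j.
Proof. by rewrite mxE; apply: eq_bigr => j _; rewrite !mxE. Qed.

Lemma expected_payoff_le Z y v : (forall i : 'I_N.+1,
    Z i * \sum_(j : 'I_N.+1 | (j <= i)%N) y j 0 <= v) ->
  forall x, prob_vector x -> expected_payoff Z x y <= v.
Proof.
move=> rows_le x [x_ge0 x_sum1].
rewrite expected_payoff_rows -[v]mul1r -x_sum1 mulr_suml.
by apply: ler_sum => i _; apply: ler_wpM2l.
Qed.

(** Averaging the affine column bound over [y] evaluates it at the average power; since [c >= 0] it
    is smallest at the largest allowed power, [Jave]. *)
Lemma expected_payoff_ge J Z (Jave : R) x (b c : R) : 0 <= c ->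
    (forall j : 'I_N.+1,
       c * (b - J j) <= \sum_(i : 'I_N.+1 | (j <= i)%N) x i 0 * Z i) ->
  forall y, jammer_strategy J Jave y ->
    c * (b - Jave) <= expected_payoff Z x y.
Proof.
move=> c_ge0 cols_ge y [[y_ge0 y_sum1]]; rewrite average_powerE => y_power.
have -> : c * (b - Jave) = c * (b - \sum_j y j 0 * J j)
    - c * (Jave - \sum_j y j 0 * J j) by ring.
rewrite lerBlDr expected_payoff_cols -[leLHS]addr0 lerD //; last first.
  by rewrite mulr_ge0 // subr_ge0.
rewrite -[in leLHS](mulr1 b) -y_sum1 mulr_sumr -sumrB mulr_sumr.
by apply: ler_sum => j _; rewrite [y j 0 * _]mulrC -mulrBl mulrA ler_wpM2r.
Qed.

(** In any equilibrium, the jammer's deviation to [ys] bounds the payoff above by [v], and the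
    transmitter's deviation to [xs] bounds it below. *)
Lemma saddle_point J Z (Jave : R) xs ys v :
    prob_vector xs -> jammer_strategy J Jave ys ->
    (forall x, prob_vector x -> expected_payoff Z x ys <= v) ->
    (forall y, jammer_strategy J Jave y -> v <= expected_payoff Z xs y) ->
  (forall x y, nash_equilibrium J Z Jave x y -> expected_payoff Z x y = v) /\
  nash_equilibrium J Z Jave xs ys.
Proof.
move=> xsP ysP ys_le xs_ge.
have payE : expected_payoff Z xs ys = v by apply: le_anti; rewrite ys_le ?xs_ge.
split=> [x y [xP yP x_opt y_opt]|].
  apply: le_anti; rewrite (le_trans (y_opt _ ysP)) ?ys_le //=.
  exact: le_trans (xs_ge _ yP) (x_opt _ xsP).
by split=> // *; rewrite payE; [apply: ys_le | apply: xs_ge].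
Qed.

End ExpectedPayoff.

Lemma big_ord_truncate (R : nmodType) (n p : nat) (F : nat -> R) :
  (n <= p)%N -> (forall i, (n <= i)%N -> F i = 0) ->
  \sum_(i < p) F i = \sum_(i < n) F i.
Proof.
move=> np F0; rewrite (big_ord_widen _ F np) [RHS]big_mkcond.
by apply: eq_bigr => i _; case: ltnP => // /F0.
Qed.

(** * Algebra of the power thresholds *)

Section Thresholds.

Variables (R : realFieldType) (J Z : nat -> R).

Lemma Jave_thresholdE m : Jave_threshold J Z m =
  Z m * \sum_(j < m) ((Z j.+1)^-1 - (Z j)^-1) * J j.+1.
Proof. by rewrite /Jave_threshold big_add1 big_mkord. Qed.

(** Splitting off the last term rescales the old sum by [Z m.+1 / Z m], so the gap up to [J m.+1] is
    multiplied by this ratio. *)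
Lemma Jave_thresholdS m : Z m != 0 -> Z m.+1 != 0 ->
  Jave_threshold J Z m.+1
  = J m.+1 - Z m.+1 / Z m * (J m.+1 - Jave_threshold J Z m).
Proof.
move=> Zm0 ZSm0; rewrite !Jave_thresholdE big_ord_recr /=.
by field; apply/andP.
Qed.

(* Summation by parts. *)
Lemma sum_power_steps m : J 0%N = 0 -> (forall i, (i <= m)%N -> Z i != 0) ->
  Z m * \sum_(i < m.+1) (J i.+1 - J i) / Z i = J m.+1 - Jave_threshold J Z m.
Proof.
move=> J0 Z0; rewrite Jave_thresholdE.
have -> : \sum_(i < m.+1) (J i.+1 - J i) / Z i
    = J m.+1 / Z m - \sum_(j < m) ((Z j.+1)^-1 - (Z j)^-1) * J j.+1.
  elim: m {Z0} => [|m IHm]; first by rewrite big_ord1 big_ord0 J0 !subr0.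
  by rewrite big_ord_recr /= IHm [in RHS]big_ord_recr /=; ring.
by field; apply: Z0.
Qed.

End Thresholds.

(** * Admissibility and guarantees of the two candidate strategies *)

Section Optimality.

Variables (R : realFieldType) (N : nat) (J Z : nat -> R) (Jave : R) (m : nat).
Hypotheses (J0 : J 0%N = 0)
  (J_incr : forall i, (i < N)%N -> J i < J i.+1)
  (Z_decr : forall i, (i < N)%N -> Z i.+1 < Z i)
  (ZN_gt0 : 0 < Z N) (mN : (m < N)%N)
  (Jave_gt : Jave_threshold J Z m < Jave)
  (Jave_lt : Jave < Jave_threshold J Z m.+1).

Lemma payoff_anti i j : (i <= j)%N -> (j <= N)%N -> Z j <= Z i.
Proof.
elim: j => [|j IHj]; first by rewrite leqn0 => /eqP ->.
rewrite leq_eqVlt => /predU1P[->//|ij] jN.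
exact: le_trans (ltW (Z_decr jN)) (IHj ij (ltnW jN)).
Qed.

Lemma power_mono i j : (i <= j)%N -> (j <= N)%N -> J i <= J j.
Proof.
elim: j => [|j IHj]; first by rewrite leqn0 => /eqP ->.
rewrite leq_eqVlt => /predU1P[->//|ij] jN.
exact: le_trans (IHj ij (ltnW jN)) (ltW (J_incr jN)).
Qed.

Lemma payoff_gt0 i : (i <= N)%N -> 0 < Z i.
Proof. by move=> iN; apply: lt_le_trans ZN_gt0 (payoff_anti iN (leqnn N)). Qed.

Lemma payoff_neq0 i : (i <= N)%N -> Z i != 0.
Proof. by move/payoff_gt0/gt_eqF/negbT. Qed.

(* By [Jave_thresholdS] the threshold [m.+1] is a proper convex combination of
   threshold [m] and [J m.+1], so a larger threshold [m.+1] lies strictly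
   between them. *)
Lemma Jave_threshold_lt_power : Jave_threshold J Z m < J m.+1.
Proof.
have := lt_trans Jave_gt Jave_lt.
rewrite Jave_thresholdS ?payoff_neq0 // 1?ltnW //.
set T := Jave_threshold _ _ _; set r := _ / _.
have r_lt1 : r < 1 by rewrite ltr_pdivrMr ?payoff_gt0 ?mul1r ?Z_decr // ltnW.
rewrite -subr_gt0.
have -> : J m.+1 - r * (J m.+1 - T) - T = (1 - r) * (J m.+1 - T) by ring.
by rewrite pmulr_rgt0 subr_gt0.
Qed.

(** By the recurrence, threshold [m.+1] is [J m.+1] minus a nonnegative multiple of the gap. *)
Lemma Jave_lt_power : Jave < J m.+1.
Proof.
apply: lt_le_trans Jave_lt _.
rewrite Jave_thresholdS ?payoff_neq0 // 1?ltnW // gerBl mulr_ge0 //.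
  by rewrite divr_ge0 ?ltW ?payoff_gt0 // ltnW.
by rewrite subr_ge0 ltW ?Jave_threshold_lt_power.
Qed.

Lemma gap_gt0 : 0 < J m.+1 - Jave_threshold J Z m.
Proof. by rewrite subr_gt0 Jave_threshold_lt_power. Qed.

Lemma jammer_scale_gt0 : 0 < jammer_scale J Z Jave m.
Proof. by rewrite divr_gt0 ?gap_gt0 // subr_gt0 Jave_lt_power. Qed.

Lemma prob_transmitter_opt : prob_vector (transmitter_opt N J Z m).
Proof.
split=> [i|].
  rewrite mxE; case: leqP => // im; have iN := leq_ltn_trans im mN.
  by rewrite !mulr_ge0 ?invr_ge0 ?subr_ge0 // ltW ?Jave_threshold_lt_power
    ?J_incr ?payoff_gt0 // ltnW.
pose c := Z m / (J m.+1 - Jave_threshold J Z m).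
pose F i := if (i <= m)%N then c * (J i.+1 - J i) * (Z i)^-1 else 0.
rewrite (eq_bigr (fun i : 'I_N.+1 => F i)) => [|i _]; last by rewrite mxE.
rewrite (@big_ord_truncate _ m.+1) 1?ltnW // => [|i]; last first.
  by rewrite /F ltnNge => /negbTE ->.
rewrite (eq_bigr (fun i : 'I_m.+1 => c * ((J i.+1 - J i) / Z i))) => [|i _].
  (* Summation by parts turns [Z m] times the remaining sum into the denominator of [c]. *)
  rewrite -mulr_sumr /c mulrAC sum_power_steps ?divff ?gt_eqF ?gap_gt0 //.
  by move=> i im; rewrite payoff_neq0 // (leq_trans im) 1?ltnW.
by rewrite /F -ltnS ltn_ord mulrA.
Qed.

(** The factor [Z i] cancels the inverse payoff in the strategy, so the column sum telescopes. *)
Lemma transmitter_opt_col (j : 'I_N.+1) :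
  Z m / (J m.+1 - Jave_threshold J Z m) * (J m.+1 - J j)
  <= \sum_(i : 'I_N.+1 | (j <= i)%N) transmitter_opt N J Z m i 0 * Z i.
Proof.
set c := _ / _.
have c_ge0 : 0 <= c by rewrite divr_ge0 ?ltW ?payoff_gt0 ?gap_gt0 // ltnW.
pose F i := if (i <= m)%N then c * (J i.+1 - J i) else 0.
have -> : \sum_(i : 'I_N.+1 | (j <= i)%N) transmitter_opt N J Z m i 0 * Z i
    = \sum_(j <= i < m.+1) c * (J i.+1 - J i).
  rewrite (eq_bigr (fun i : 'I_N.+1 => F i)) => [|i _]; last first.
    rewrite mxE /F; case: ifP => _; last by rewrite mul0r.
    by rewrite divfK // payoff_neq0 // -ltnS.
  rewrite -(big_mkord (fun i => (j <= i)%N) F) -(big_nat_widenl j 0 _ xpredT) //.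
  rewrite [RHS](big_nat_widen _ _ N.+1) 1?ltnW // [RHS]big_mkcond.
  by apply: eq_bigr => i _; rewrite ltnS.
(* Up to [m.+1] the bound is an equality; beyond, the column sum is empty and the affine function is
   nonpositive. *)
case: (leqP j m.+1) => jm.
  by rewrite -mulr_sumr telescope_sumr.
rewrite big_geq 1?ltnW // mulr_ge0_le0 // subr_le0 power_mono ?(ltnW jm) //.
by rewrite -ltnS.
Qed.

Let a := jammer_scale J Z Jave m.
Let w := a * Z m * ((Jave - Jave_threshold J Z m) / (J m.+1 - Jave)) * (Z m)^-1.
(** The jammer's weights as a sequence on [nat], so that partial sums can be computed by
    induction. *)
Let ys j := if j == 0%N then a * Z m * (Z 0%N)^-1
  else if (j <= m)%N then a * Z m * ((Z j)^-1 - (Z j.-1)^-1)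
  else if j == m.+1 then w else 0.

Let ys_eq0 j : (m.+2 <= j)%N -> ys j = 0.
Proof.
move=> jm; rewrite /ys (gtn_eqF (ltn_trans _ jm)) //.
by rewrite leqNgt (ltn_trans _ jm) //= (gtn_eqF jm).
Qed.

Let ysS_le j : (j < m)%N -> ys j.+1 = a * Z m * ((Z j.+1)^-1 - (Z j)^-1).
Proof. by move=> jm; rewrite /ys /= jm. Qed.

Let ysSm : ys m.+1 = w.
Proof. by rewrite /ys /= ltnn eqxx. Qed.

(** The increments of [1 / Z] telescope; cumulative mass inverse to the payoff is what equalizes the
    rows up to [m]. *)
Let sum_ys_le i : (i <= m)%N -> \sum_(j < i.+1) ys j = a * Z m / Z i.
Proof.
elim: i => [|i IHi] im; first by rewrite big_ord1.
by rewrite big_ord_recr /= IHi 1?ltnW // ysS_le //; ring.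
Qed.

Let powerBJave_neq0 : J m.+1 - Jave != 0.
Proof. by rewrite gt_eqF // subr_gt0 Jave_lt_power. Qed.

Let gap_neq0 : J m.+1 - Jave_threshold J Z m != 0.
Proof. by rewrite gt_eqF // gap_gt0. Qed.

(** Levels up to [m] carry mass [a], and level [m.+1] carries [w = 1 - a]. *)
Let sum_ys_all p : (m.+2 <= p)%N -> \sum_(j < p) ys j = 1.
Proof.
move=> mp; rewrite (@big_ord_truncate _ m.+2) // big_ord_recr /=.
rewrite sum_ys_le // ysSm /w /a /jammer_scale; field.
by rewrite gap_neq0 payoff_neq0 // 1?ltnW ?powerBJave_neq0.
Qed.

Let jammer_optE (j : 'I_N.+1) : jammer_opt N J Z Jave m j 0 = ys j.
Proof. by rewrite mxE. Qed.

Lemma jammer_opt_strategy : jammer_strategy J Jave (jammer_opt N J Z Jave m).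
Proof.
have Zm_gt0 : 0 < Z m by rewrite payoff_gt0 // ltnW.
have aZm_ge0 : 0 <= a * Z m by rewrite ltW // mulr_gt0 // jammer_scale_gt0.
split; first split=> [j|].
- rewrite jammer_optE /ys; have jN : (j <= N)%N by rewrite -ltnS.
  case: eqP => _; first by rewrite mulr_ge0 // invr_ge0 ltW // payoff_gt0.
  case: leqP => _.
    have predjN := leq_trans (leq_pred j) jN.
    by rewrite mulr_ge0 // subr_ge0 lef_pV2 ?posrE ?payoff_gt0 ?payoff_anti
      ?leq_pred.
  case: ifP => // _; rewrite /w mulr_ge0 ?invr_ge0 ?(ltW Zm_gt0) //.
  by rewrite mulr_ge0 // divr_ge0 // subr_ge0 ltW ?Jave_lt_power.
- by rewrite (eq_bigr (fun j : 'I_N.+1 => ys j)) ?sum_ys_all.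
rewrite average_powerE (eq_bigr (fun j : 'I_N.+1 => ys j * J j)); last first.
  by move=> j _; rewrite jammer_optE.
rewrite (@big_ord_truncate _ m.+2 _ (fun j => ys j * J j)) //; last first.
  by move=> j jm; rewrite ys_eq0 ?mul0r.
(* Level 0 costs no power; levels 1 to [m] cost [a] times threshold [m]. *)
rewrite big_ord_recr big_ord_recl /= J0 mulr0 add0r.
have -> : \sum_(j < m) ys (bump 0 j) * J (bump 0 j)
    = a * Jave_threshold J Z m.
  rewrite Jave_thresholdE mulrA mulr_sumr; apply: eq_bigr => j _.
  by rewrite /bump /= add1n ysS_le // mulrA.
(* Adding [w * J m.+1] gives exactly [Jave]: the power constraint is tight. *)
rewrite ysSm le_eqVlt; apply/predU1P; left; rewrite /w /a /jammer_scale; field.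
by rewrite gap_neq0 gt_eqF ?powerBJave_neq0.
Qed.

Lemma jammer_opt_row (i : 'I_N.+1) :
  Z i * \sum_(j : 'I_N.+1 | (j <= i)%N) jammer_opt N J Z Jave m j 0
  <= jammer_scale J Z Jave m * Z m.
Proof.
rewrite (eq_bigr (fun j : 'I_N.+1 => ys j)) => [|j _]; last exact: jammer_optE.
rewrite -(@big_ord_widen _ _ _ i.+1 _ ys) //; have iN : (i <= N)%N by rewrite -ltnS.
case: (leqP i m) => im.
  by rewrite sum_ys_le // mulrC divfK // payoff_neq0.
rewrite sum_ys_all // mulr1 (le_trans (payoff_anti im iN)) //.
have Zm_gt0 : 0 < Z m by rewrite payoff_gt0 // ltnW.
(* With denominators cleared and the recurrence applied, this is [Jave] being at most threshold
   [m.+1]. *)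
rewrite -ler_pdivrMr // /jammer_scale ler_pdivlMr ?gap_gt0 //.
have := Jave_lt; rewrite Jave_thresholdS ?payoff_neq0 // 1?ltnW //; lra.
Qed.

End Optimality.

Theorem theorem3 (R : realFieldType) (N : nat) (J Z : nat -> R) (Jave : R)
    (m : nat)
    (hN : (1 <= N)%N)
    (hJ0 : J 0%N = 0)
    (hJ : forall i : nat, (i < N)%N -> J i < J i.+1)
    (hZ : forall i : nat, (i < N)%N -> Z i.+1 < Z i)
    (hZN : 0 < Z N)
    (hJave : 0 <= Jave <= J N)
    (hm : (m < N)%N)
    (hmJ : Jave_threshold J Z m < Jave < Jave_threshold J Z m.+1) :
  (forall x y : 'cV[R]_(N.+1), nash_equilibrium J Z Jave x y ->
     expected_payoff Z x y
     = (J m.+1 - Jave) / (J m.+1 - Jave_threshold J Z m) * Z m) /\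
  nash_equilibrium J Z Jave
    (transmitter_opt N J Z m) (jammer_opt N J Z Jave m).
Proof.
have /andP[Jave_gt Jave_lt] := hmJ.
apply: saddle_point.
- exact: (prob_transmitter_opt (Jave := Jave)).
- exact: jammer_opt_strategy.
- by apply: expected_payoff_le => i; apply: jammer_opt_row.
(* The value is the affine column bound, with [b = J m.+1], evaluated at power [Jave]. *)
have -> : (J m.+1 - Jave) / (J m.+1 - Jave_threshold J Z m) * Z m
    = Z m / (J m.+1 - Jave_threshold J Z m) * (J m.+1 - Jave) by ring.
apply: expected_payoff_ge => [|j]; last first.
  exact: (transmitter_opt_col (Jave := Jave)).
rewrite divr_ge0 ?ltW ?(payoff_gt0 hZ hZN) 1?ltnW //.
exact: (gap_gt0 hZ hZN hm Jave_gt Jave_lt).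
Qed.
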